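(* Let $n\ge 3$ and let $\widetilde L$ be a one-dimensional non-split extension of the solvable Lie algebra $\mathfrak{s}^2_{n,1}$. Then $\widetilde L$ is isomorphic to one of the algebras $$\mathfrak{s}^2_{n+1,1},\qquad \mathfrak{s}^4_{n+1,1}(0,0,\dots,0,1),\qquad \tau^3_{n+1,1}(0,0,\dots,0),$$ where the last algebra is defined only for $n$ odd.
   Context: All algebras are finite-dimensional over $\mathbb{C}$; brackets are antisymmetric and unlisted brackets of basis vectors are zero. $\mathfrak{s}^2_{n,1}$: basis $x,e_1,\dots,e_n$; $[e_i,e_1]=e_{i+1}$ ($2\le i\le n-1$), $[e_i,x]=e_i$ ($2\le i\le n$). Its nilradical is $N=n_{n,1}=\langle e_1,\dots,e_n\rangle$. $\mathfrak{s}^4_{m,1}(\alpha_3,\alpha_4,\dots,\alpha_{m-1})$: basis $x,e_1,\dots,e_m$; $[e_i,e_1]=e_{i+1}$ ($2\le i\le m-1$), $[e_i,x]=e_i+\sum_{l=i+2}^{m}\alpha_{l+1-i}e_l$ ($2\le i\le m$). Thus $\mathfrak{s}^4_{n+1,1}(0,\dots,0,1)$ has $\alpha_3=\dots=\alpha_{n-1}=0$, $\alpha_n=1$. $\tau^3_{2m,1}(0,\dots,0)$: basis $x,e_1,\dots,e_{2m}$; $[e_i,e_1]=e_{i+1}$ ($2\le i\le 2m-2$), $[e_i,e_{2m+1-i}]=(-1)^ie_{2m}$ ($2\le i\le m$), $[e_i,x]=e_i$ ($2\le i\le 2m-1$), $[e_{2m},x]=2e_{2m}$. Extensions: let $L$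 be a solvable Lie algebra with nilradical $N$, $\mathbb V$ a vector space, $\theta:L\to\operatorname{End}\mathbb V$ a representation, and $\psi:L\times L\to\mathbb V$ an antisymmetric bilinear map with $$\psi(x,[y,z])+\psi(z,[x,y])+\psi(y,[z,x])+\theta(x)\psi(y,z)+\theta(z)\psi(x,y)+\theta(y)\psi(z,x)=0 .$$ The extension $L(\psi,\theta)$ of $L$ by $\mathbb V$ is $L\oplus\mathbb V$ with bracket $[x+u,y+v]=[x,y]+\psi(x,y)+\theta(x)v-\theta(y)u$. Only extensions whose nilradical is a central extension of $N$ by $\mathbb V$ are considered, equivalently $N\subseteq\operatorname{Ker}\theta$. The extension is one-dimensional if $\dim\mathbb V=1$. Put $\psi^0=\psi|_{N\times N}$ and $\operatorname{Ann}(\psi^0)=\{x\in N:\psi^0(x,N)=0\}$; a one-dimensional extension is non-split if $\operatorname{Ann}(\psi^0)\cap Z(N)=0$, where $Z(N)$ is the center of $N$. *)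

(* Defs.v *)
From HB Require Import structures.
From mathcomp Require Import all_boot all_order all_algebra.
From mathcomp Require Import ring zify.
From mathcomp Require Import reals complex.

Set Implicit Arguments.
Unset Strict Implicit.
Unset Printing Implicit Defensive.

Import GRing.Theory VectorInternalTheory.
Local Open Scope ring_scope.

Record lieAlgebra (K : numFieldType) := LieAlgebra {
  lie_sort :> vectType K;
  lie : lie_sort -> lie_sort -> lie_sort;
  lie_linear : forall z, linear (fun x => lie x z);
  lie_antisym : forall x y, lie x y = - lie y x;
  lie_jacobi : forall x y z,
    lie x (lie y z) + lie y (lie z x) + lie z (lie x y) = 0
}.

Notation "[ 'Lie' x , y ]" := (lie x y) (at level 0, x, y at level 99,
  format "[ 'Lie'  x ,  y ]") : ring_scope.

Section LieNotions.

Variable K : numFieldType.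
Implicit Types L M : lieAlgebra K.

Definition lie_isomorphic L M : Prop :=
  exists f : {linear L -> M},
    bijective f /\ forall x y : L, f [Lie x, y] = [Lie f x, f y].

Definition lie_prod L (U W : {vspace L}) : {vspace L} :=
  <<[seq [Lie u, w] | u <- vbasis U, w <- vbasis W]>>%VS.

(* lower_central I k is the (k+1)-st term I^(k+1) of the series *)
(* I^1 = I, I^(k+1) = [I, I^k].                                 *)
Fixpoint lower_central L (I : {vspace L}) (k : nat) : {vspace L} :=
  if k is k'.+1 then lie_prod I (lower_central I k') else I.

Definition lie_ideal L (I : {vspace L}) : Prop :=
  forall x y : L, y \in I -> [Lie x, y] \in I.

Definition lie_nilpotent L (I : {vspace L}) : Prop :=
  exists k, lower_central I k = 0%VS.

Definition is_nilradical L (N : {vspace L}) : Prop :=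
  [/\ lie_ideal N, lie_nilpotent N &
      forall I : {vspace L}, lie_ideal I -> lie_nilpotent I -> (I <= N)%VS].

Definition in_center L (N : {vspace L}) (z : L) : Prop :=
  z \in N /\ forall y : L, y \in N -> [Lie z, y] = 0.

Record ext_data L (V : vectType K) := ExtData {
  ext_theta : {linear L -> 'End(V)};
  ext_thetaP : forall x y : L, ext_theta [Lie x, y] =
    (ext_theta x \o ext_theta y)%VF - (ext_theta y \o ext_theta x)%VF;
  ext_psi : L -> L -> V;
  ext_psi_linear : forall z, linear (fun x => ext_psi x z);
  ext_psi_antisym : forall x y, ext_psi x y = - ext_psi y x;
  ext_psi_cocycle : forall x y z : L,
    ext_psi x [Lie y, z] + ext_psi z [Lie x, y] + ext_psi y [Lie z, x]
    + ext_theta x (ext_psi y z) + ext_theta z (ext_psi x y)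
    + ext_theta y (ext_psi z x) = 0
}.

Section Extension.

Variables (L : lieAlgebra K) (V : vectType K) (E : ext_data L V).

Definition ext_lie (a b : (L * V)%type) : (L * V)%type :=
  ([Lie a.1, b.1],
   ext_psi E a.1 b.1 + ext_theta E a.1 b.2 - ext_theta E b.1 a.2).

Lemma ext_lie_linear b : linear (fun a => ext_lie a b).
Proof.
move=> c a a'; congr pair; rewrite /=; first exact: lie_linear.
rewrite ext_psi_linear !linearP /= add_lfunE scale_lfunE.
apply: (@v2r_inj _ V); rewrite !(linearD, linearN, linearZ) /=.
by apply/rowP => i; rewrite !mxE; ring.
Qed.

Lemma ext_lie_antisym a b : ext_lie a b = - ext_lie b a.
Proof.
congr pair; first exact: lie_antisym.
by rewrite /= [in LHS]ext_psi_antisym !opprD opprK -!addrA; congr (_ + _);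
   rewrite addrC.
Qed.

Lemma ext_lie_jacobi a b c :
  ext_lie a (ext_lie b c) + ext_lie b (ext_lie c a) + ext_lie c (ext_lie a b)
  = 0.
Proof.
congr pair; rewrite /=; first exact: lie_jacobi.
move: a b c => [x u] [y v] [z w] /=.
rewrite !ext_thetaP !linearD !linearN /= !add_lfunE !opp_lfunE !comp_lfunE.
rewrite -[RHS](ext_psi_cocycle E x y z).
set p1 := ext_psi E x _; set p2 := ext_psi E y _; set p3 := ext_psi E z _.
set a1 := ext_theta E x (ext_psi E _ _).
set a2 := ext_theta E y (ext_psi E _ _).
set a3 := ext_theta E z (ext_psi E _ _).
set b1 := ext_theta E x (ext_theta E y _).
set b2 := ext_theta E y (ext_theta E x _).
set c1 := ext_theta E y (ext_theta E z _).
set c2 := ext_theta E z (ext_theta E y _).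
set d1 := ext_theta E z (ext_theta E x _).
set d2 := ext_theta E x (ext_theta E z _).
apply: (@v2r_inj _ V); rewrite !(linearD, linearN) /=.
by apply/rowP => i; rewrite !mxE; ring.
Qed.

(* L + V with [x + u, y + v] = [x, y] + psi(x, y) + theta(x) v - theta(y) u *)
Definition extension : lieAlgebra K :=
  LieAlgebra ext_lie_linear ext_lie_antisym ext_lie_jacobi.

(* When N is the nilradical of L, this says that the nilradical of the *)
(* extension is a central extension of N by V.                         *)
Definition ext_central (N : {vspace L}) : Prop :=
  forall x : L, x \in N -> ext_theta E x = 0.

(* Ann(psi|N x N) meets Z(N) trivially. *)
Definition ext_nonsplit (N : {vspace L}) : Prop :=
  forall z : L, in_center N z ->
    (forall y : L, y \in N -> ext_psi E z y = 0) -> z = 0.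

End Extension.

Section StructureConstants.

Variable n : nat.
Implicit Types (u v w : 'rV[K]_n.+1) (t : nat -> nat -> 'rV[K]_n.+1).

(* The basis x, e_1, ..., e_n of 'rV[K]_n.+1: bvec 0 is x and bvec i is e_i *)
(* (bvec i = 0 when i > n).                                                 *)
Definition bvec (i : nat) : 'rV[K]_n.+1 := \row_(j < n.+1) (i == j)%:R.

(* Bilinear antisymmetric extension of a table t that lists a bracket        *)
(* t i j = [bvec i, bvec j] in at most one of the two orders (i, j), (j, i), *)
(* and is 0 elsewhere.                                                       *)
Definition table_lie t v w : 'rV[K]_n.+1 :=
  \sum_(i < n.+1) \sum_(j < n.+1)
    (v 0 i * w 0 j - v 0 j * w 0 i) *: t i j.

Lemma table_lie_linear t w : linear (fun v => table_lie t v w).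
Proof.
move=> c v v'; rewrite /table_lie scaler_sumr -big_split; apply: eq_bigr => i _.
rewrite scaler_sumr -big_split; apply: eq_bigr => j _ /=.
by rewrite scalerA -scalerDl !mxE; congr (_ *: _); ring.
Qed.

Lemma table_lie_antisym t v w : table_lie t v w = - table_lie t w v.
Proof.
rewrite /table_lie -sumrN; apply: eq_bigr => i _.
rewrite -sumrN; apply: eq_bigr => j _.
by rewrite -scaleNr; congr (_ *: _); ring.
Qed.

Lemma table_lie_bvec t i j : (i <= n)%N -> (j <= n)%N ->
  table_lie t (bvec i) (bvec j) = t i j - t j i.
Proof.
move=> Hi Hj; have H k l (Hk : (k < n.+1)%N) (Hl : (l < n.+1)%N) :
  \sum_(i0 < n.+1) \sum_(j0 < n.+1) (bvec k 0 i0 * bvec l 0 j0) *: t i0 j0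
    = t k l.
  rewrite (bigD1 (Ordinal Hk)) //= (bigD1 (Ordinal Hl)) //= !mxE /= !eqxx.
  rewrite mulr1 scale1r !big1 ?addr0 //= => [a|a].
    rewrite -val_eqE /= eq_sym => /negPf Ha.
    by rewrite big1 // => b _; rewrite !mxE Ha mul0r scale0r.
  by rewrite -val_eqE /= eq_sym => /negPf Ha; rewrite !mxE Ha mulr0 scale0r.
rewrite /table_lie -(H i j) // -(H j i) // -sumrB; apply: eq_bigr => a _.
rewrite -sumrB; apply: eq_bigr => b _.
by rewrite scalerBl; congr (_ - _ *: _); rewrite mulrC.
Qed.

Lemma linear_fun_opp (f : 'rV[K]_n.+1 -> 'rV[K]_n.+1) :
  linear f -> {morph f : u / - u}.
Proof.
move=> flin u; pose F : {linear 'rV[K]_n.+1 -> 'rV[K]_n.+1} :=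
  HB.pack f (GRing.isLinear.Build _ _ _ _ f flin).
exact: (linearN F).
Qed.

Lemma linear_fun0 (f : 'rV[K]_n.+1 -> 'rV[K]_n.+1) : linear f -> f 0 = 0.
Proof.
move=> flin; pose F : {linear 'rV[K]_n.+1 -> 'rV[K]_n.+1} :=
  HB.pack f (GRing.isLinear.Build _ _ _ _ f flin).
exact: (linear0 F).
Qed.

Lemma row_linear0 (f : 'rV[K]_n.+1 -> 'rV[K]_n.+1) :
  linear f -> (forall i, (i <= n)%N -> f (bvec i) = 0) -> forall u, f u = 0.
Proof.
move=> flin f0 u.
pose F : {linear 'rV[K]_n.+1 -> 'rV[K]_n.+1} :=
  HB.pack f (GRing.isLinear.Build _ _ _ _ f flin).
have -> : f u = F u by [].
rewrite [u]row_sum_delta linear_sum big1 // => i _; rewrite linearZ /=.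
have -> : delta_mx 0 i = bvec i :> 'rV[K]_n.+1.
  by apply/rowP => j; rewrite !mxE eq_sym.
by rewrite f0 ?scaler0 // -ltnS.
Qed.

Definition jacobiator t u v w :=
  table_lie t u (table_lie t v w) + table_lie t v (table_lie t w u)
  + table_lie t w (table_lie t u v).

Lemma table_lie_jacobi t :
    (forall i j k, (i < j)%N -> (j < k)%N -> (k <= n)%N ->
       jacobiator t (bvec i) (bvec j) (bvec k) = 0) ->
  forall u v w, jacobiator t u v w = 0.
Proof.
set J := jacobiator t => H0.
have Sl w := table_lie_linear t w.
have Sa := table_lie_antisym t.
have Sr v : linear (table_lie t v).
  by move=> c w w'; rewrite Sa Sl opprD -scalerN -!Sa.
have Sxx v : table_lie t v v = 0.
  rewrite /table_lie big1 // => i _; rewrite big1 // => j _.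
  by rewrite mulrC subrr scale0r.
have SN v w : table_lie t v (- w) = - table_lie t v w.
  exact: linear_fun_opp (Sr v) w.
have S0 v : table_lie t v 0 = 0 by exact: linear_fun0 (Sr v).
have Jc u v w : J u v w = J v w u by rewrite /J /jacobiator -addrA addrC.
have Js u v w : J u v w = - J v u w.
  rewrite /J /jacobiator (Sa v w) (Sa w u) (Sa u v) !SN !opprD.
  by congr (_ + _); rewrite addrC.
have Jl v w : linear (fun u => J u v w).
  move=> c u u'; rewrite /J /jacobiator (Sl (table_lie t v w)) (Sr w) (Sr v).
  rewrite (Sl v) (Sr w); move: (table_lie _ _ _) (table_lie _ _ _) (table_lie _ _ _).
  move=> a1 a2 a3; move: (table_lie _ _ _) (table_lie _ _ _) (table_lie _ _ _).
  by move=> b1 b2 b3; apply/rowP => i; rewrite !mxE; ring.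
have Jxx v w : J v v w = 0.
  by rewrite /J /jacobiator Sxx S0 (Sa w v) SN subrr addr0.
have Jb i j k : (i <= n)%N -> (j <= n)%N -> (k <= n)%N ->
    J (bvec i) (bvec j) (bvec k) = 0.
  have H1 a b c : (a < b)%N -> (a < c)%N -> (b <= n)%N -> (c <= n)%N ->
      J (bvec a) (bvec b) (bvec c) = 0.
    move=> ab ac bn cn; have [bc|cb|<-] := ltngtP b c; first exact: H0.
      by rewrite Jc Js -Jc H0 ?oppr0.
    by rewrite Jc Jxx.
  have H2 a b c : (a < b)%N -> (a <= n)%N -> (b <= n)%N -> (c <= n)%N ->
      J (bvec a) (bvec b) (bvec c) = 0.
    move=> ab an bn cn; have [ac|ca|<-] := ltngtP a c; first exact: H1.
      by rewrite -Jc H1 // (ltn_trans ca).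
    by rewrite -Jc Jxx.
  move=> Hi Hj Hk; have [ij|ji|<-] := ltngtP i j; first exact: H2.
    by rewrite Js H2 ?oppr0.
  exact: Jxx.
have J1 i j w : (i <= n)%N -> (j <= n)%N -> J w (bvec i) (bvec j) = 0.
  by move=> Hi Hj; apply: (row_linear0 (Jl _ _)) => k Hk; apply: Jb.
have J2 i v w : (i <= n)%N -> J v w (bvec i) = 0.
  by move=> Hi; apply: (row_linear0 (Jl _ _)) => k Hk; rewrite Jc J1.
by move=> u v w; apply: (row_linear0 (Jl _ _)) => k Hk; rewrite Jc J2.
Qed.

End StructureConstants.


End LieNotions.

Ltac ifs := repeat (case: ifP => ?; try (exfalso; lia)).

Section Families.

Variable K : numFieldType.

Definition s2_table (n i j : nat) : 'rV[K]_n.+1 :=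
  if (j == 1)%N && (2 <= i <= n - 1)%N then bvec K n i.+1
  else if (j == 0)%N && (2 <= i <= n)%N then bvec K n i
  else 0.

(* Only the values alpha 3, ..., alpha (m - 1) are used. *)
Definition s4_table (m : nat) (alpha : nat -> K) (i j : nat) : 'rV[K]_m.+1 :=
  if (j == 1)%N && (2 <= i <= m - 1)%N then bvec K m i.+1
  else if (j == 0)%N && (2 <= i <= m)%N then
    bvec K m i + \sum_(i + 2 <= l < m.+1) alpha (l + 1 - i)%N *: bvec K m l
  else 0.

(* The member tau^3_{2m,1}(0, ..., 0) of its family, of dimension 2 m + 1. *)
Definition tau3_table (m i j : nat) : 'rV[K]_m.*2.+1 :=
  if (j == 1)%N && (2 <= i <= m.*2 - 2)%N then bvec K m.*2 i.+1
  else if (i + j == m.*2 + 1)%N && (2 <= i <= m)%N then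
    (-1) ^+ i *: bvec K m.*2 m.*2
  else if (j == 0)%N && (2 <= i <= m.*2 - 1)%N then bvec K m.*2 i
  else if (j == 0)%N && (i == m.*2)%N then 2 *: bvec K m.*2 m.*2
  else 0.

Lemma bvec_gt n i : (n < i)%N -> bvec K n i = 0.
Proof.
by move=> ni; apply/rowP => j; rewrite !mxE; case: eqP => // E;
   have := ltn_ord j; lia.
Qed.

Section TableLin.

Variables (n : nat) (t : nat -> nat -> 'rV[K]_n.+1).
Implicit Types v w : 'rV[K]_n.+1.

Lemma table_lie_linear_r v : linear (table_lie t v).
Proof.
move=> c u u'; rewrite table_lie_antisym table_lie_linear opprD -scalerN.
by rewrite -!table_lie_antisym.
Qed.

Lemma table_lie0 v : table_lie t v 0 = 0.
Proof. exact: linear_fun0 (table_lie_linear_r v). Qed.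

Lemma table_lieN v w : table_lie t v (- w) = - table_lie t v w.
Proof. exact: (linear_fun_opp (table_lie_linear_r v) w). Qed.

Lemma table_lieZ v c w : table_lie t v (c *: w) = c *: table_lie t v w.
Proof.
by have := table_lie_linear_r v c w 0; rewrite !addr0 table_lie0 addr0.
Qed.

Lemma table_lieD v w w' :
  table_lie t v (w + w') = table_lie t v w + table_lie t v w'.
Proof. by have := table_lie_linear_r v 1 w w'; rewrite !scale1r. Qed.

Lemma table_lie_sum v a b (c : nat -> K) (f : nat -> 'rV[K]_n.+1) :
  table_lie t v (\sum_(a <= l < b) c l *: f l)
  = \sum_(a <= l < b) c l *: table_lie t v (f l).
Proof.
elim/big_rec2: _ => [|l x y _ <-]; first exact: table_lie0.
by rewrite table_lieD table_lieZ.
Qed.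

End TableLin.

Lemma s4_jacobi m alpha u v w : jacobiator (s4_table m alpha) u v w = 0.
Proof.
move: u v w; apply: table_lie_jacobi => i j k ij jk km.
set t := s4_table m alpha; set e := bvec K m.
pose B k := e k + \sum_(k + 2 <= l < m.+1) alpha (l + 1 - k)%N *: e l.
have e0 p : (m < p)%N -> e p = 0 by exact: bvec_gt.
have T1 p : (2 <= p)%N -> table_lie t (e 1%N) (e p) = - e p.+1.
  move=> p2; have [pm|mp] := leqP p m; last first.
    by rewrite (e0 p) // (e0 p.+1) ?table_lie0 ?oppr0 //; lia.
  rewrite table_lie_bvec //; last lia.
  by rewrite /t /s4_table; ifs; rewrite sub0r // e0 //; lia.
have T0 p : (2 <= p)%N -> table_lie t (e 0%N) (e p) = - B p.
  move=> p2; have [pm|mp] := leqP p m; last first.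
    rewrite /B (e0 p) // big_geq; last lia.
    by rewrite addr0 table_lie0 oppr0.
  by rewrite table_lie_bvec // /t /s4_table; ifs; rewrite sub0r.
have T2 p q : (2 <= p)%N -> (2 <= q)%N -> table_lie t (e p) (e q) = 0.
  move=> p2 q2; have [pm|mp] := leqP p m; last first.
    by rewrite e0 // table_lie_antisym table_lie0 oppr0.
  have [qm|mq] := leqP q m; last by rewrite [e q]e0 // table_lie0.
  by rewrite table_lie_bvec // /t /s4_table; ifs; rewrite subrr.
have T01 : (1 <= m)%N -> table_lie t (e 0%N) (e 1%N) = 0.
  by move=> m1; rewrite table_lie_bvec // /t /s4_table; ifs; rewrite subrr.
have TB p q : (2 <= p)%N -> (2 <= q)%N -> table_lie t (e p) (B q) = 0.
  move=> p2 q2; rewrite table_lieD table_lie_sum T2 // add0r.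
  by rewrite big_nat_cond big1 // => l Hl; rewrite T2 ?scaler0 //; lia.
have T1B p : (2 <= p)%N -> table_lie t (e 1%N) (B p) = - B p.+1.
  move=> p2; rewrite table_lieD table_lie_sum T1 // opprD -sumrN.
  congr (_ + _); rewrite addSn big_add1 /=.
  have [pm|mp] := leqP (p + 2) m; last by rewrite !big_geq //; lia.
  rewrite big_nat_recr //= (T1 m) ?(e0 m.+1) //; last lia.
  rewrite oppr0 scaler0 addr0.
  apply: eq_big_nat => l Hl; rewrite T1; last lia.
  by rewrite scalerN; congr (- (alpha _ *: _)); lia.
have Sa := table_lie_antisym t.
have T0' p : (2 <= p)%N -> table_lie t (e p) (e 0%N) = B p.
  by move=> p2; rewrite Sa T0 ?opprK.
have T1' p : (2 <= p)%N -> table_lie t (e p) (e 1%N) = e p.+1.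
  by move=> p2; rewrite Sa T1 ?opprK.
rewrite /jacobiator -/t -/e.
case: i ij => [|[|i]] ij.
- case: j ij jk => [|[|j]] // _ jk.
    rewrite T01 ?(T0' k) ?(T1 k) ?table_lie0 ?table_lieN; try lia.
    rewrite (T0 k.+1) ?(T1B k); try lia.
    by rewrite opprK subrr addr0.
  rewrite (T2 j.+2 k) ?(T0' k) ?(T0 j.+2) ?table_lie0 ?table_lieN; try lia.
  by rewrite !TB ?oppr0 ?addr0 //; lia.
- rewrite (T2 j k) ?(T1' k) ?(T1 j) ?table_lie0 ?table_lieN; try lia.
  by rewrite !T2 ?oppr0 ?addr0 //; lia.
- by rewrite (T2 j k) ?(T2 k) ?(T2 i.+2 j) ?table_lie0 ?addr0 //; lia.
Qed.

Lemma s2_tableE n i j : s2_table n i j = s4_table n (fun=> 0) i j.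
Proof.
rewrite /s2_table /s4_table; do 2?case: ifP => // _.
by rewrite big1 ?addr0 // => l _; rewrite scale0r.
Qed.

Lemma s2_jacobi n u v w : jacobiator (s2_table n) u v w = 0.
Proof.
have E v' w' : table_lie (s2_table n) v' w'
               = table_lie (s4_table n (fun=> 0)) v' w'.
  rewrite /table_lie; apply: eq_bigr => i _; apply: eq_bigr => j _.
  by rewrite s2_tableE.
by rewrite /jacobiator !E; apply: s4_jacobi.
Qed.

Lemma tau3_jacobi m u v w : jacobiator (tau3_table m) u v w = 0.
Proof.
move: u v w; apply: table_lie_jacobi => i j k ij jk km.
set t := tau3_table m; set e := bvec K m.*2.
pose W p q : K := if (p + q == m.*2 + 1)%N then (-1) ^+ p else 0.
pose d p : K := if (p <= m.*2 - 2)%N then 1 else 0.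
pose c p : K := if (p <= m.*2 - 1)%N then 1 else 2.
have e0 p : (m.*2 < p)%N -> e p = 0 by exact: bvec_gt.
have T1 p : (2 <= p <= m.*2)%N ->
    table_lie t (e p) (e 1%N) = d p *: e p.+1.
  move=> p2; rewrite table_lie_bvec //; try lia.
  by rewrite /t /tau3_table /d; ifs; rewrite ?subr0 ?scale1r ?scale0r.
have T0 p : (2 <= p <= m.*2)%N -> table_lie t (e p) (e 0%N) = c p *: e p.
  move=> p2; rewrite table_lie_bvec //; try lia.
  rewrite /t /tau3_table /c; ifs; rewrite ?subr0 ?scale1r //.
  by rewrite (_ : p = m.*2) //; lia.
have T2 p q : (2 <= p <= m.*2)%N -> (2 <= q <= m.*2)%N ->
    table_lie t (e p) (e q) = W p q *: e m.*2.
  move=> p2 q2; rewrite table_lie_bvec //; try lia.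
  rewrite /t /tau3_table /W.
  ifs; rewrite ?subr0 ?scale0r //.
  rewrite sub0r -scaleNr; congr (_ *: _).
  have -> : p = (m.*2.+1 - q)%N by lia.
  rewrite -signr_odd -[in RHS]signr_odd oddB; last lia.
  by rewrite /= odd_double /=; case: (odd q); rewrite ?opprK // !(expr0, expr1).
have T01 : (1 <= m.*2)%N -> table_lie t (e 0%N) (e 1%N) = 0.
  by move=> m1; rewrite table_lie_bvec // /t /tau3_table; ifs; rewrite subrr.
have Sa := table_lie_antisym t.
have T0n p : (2 <= p <= m.*2)%N -> table_lie t (e 0%N) (e p) = - (c p *: e p).
  by move=> p2; rewrite Sa T0.
have T1n p : (2 <= p <= m.*2)%N ->
    table_lie t (e 1%N) (e p) = - (d p *: e p.+1).
  by move=> p2; rewrite Sa T1.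
rewrite /jacobiator -/t -/e.
case: i ij => [|[|i]] ij.
- case: j ij jk => [|[|j]] // _ jk.
    rewrite T01 ?(T0 k) ?(T1n k) ?table_lie0 ?table_lieN ?table_lieZ; try lia.
    rewrite addr0 (T1n k); last lia.
    rewrite /d; case: ifP => Hk.
      rewrite T0n; last lia.
      rewrite /c !ifT; try lia.
      by rewrite !scale1r opprK subrr.
    by rewrite !scale0r !oppr0 scaler0 addr0.
  rewrite (T2 j.+2 k) ?(T0 k) ?(T0n j.+2); try lia.
  rewrite table_lieN !table_lieZ T0n ?(T2 j.+2 k) ?(T2 k j.+2); try lia.
  rewrite !(scalerN, scalerA) -!scaleNr -!scalerDl.
  rewrite [X in X *: _](_ : _ = 0) ?scale0r // /W.
  have [pq|pq] := eqVneq (j.+2 + k)%N (m.*2 + 1)%N; last first.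
    by rewrite ifF; [ring | lia].
  rewrite ifT; last lia.
  rewrite /c ifF; last lia.
  rewrite !ifT; try lia.
  have -> : k = (m.*2.+1 - j.+2)%N by lia.
  rewrite -[_ ^+ j.+2]signr_odd -[_ ^+ (_ - _)]signr_odd oddB; last lia.
  by rewrite /= odd_double /= negbK; case: (odd j);
     rewrite /= !(expr0, expr1); ring.
- rewrite (T2 j k) ?(T1 k) ?(T1n j); try lia.
  rewrite table_lieN !table_lieZ T1n; last lia.
  rewrite {1}/d ifF; last lia.
  rewrite scale0r oppr0 scaler0 add0r.
  rewrite /d; have [jk2|jk2] := eqVneq (j + k)%N m.*2; last first.
    have V p q : (2 <= p)%N -> (2 <= q)%N -> (p <= m.*2)%N ->
        (p + q)%N != m.*2 ->
        (if (q <= m.*2 - 2)%N then 1 else 0 : K)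
          *: table_lie t (e p) (e q.+1) = 0.
      move=> p2 q2 pm pq; case: ifP => Hq; last by rewrite scale0r.
      rewrite T2; [|lia|lia].
      by rewrite /W ifF ?scale0r ?scaler0 //; lia.
    by rewrite !V ?oppr0 ?addr0 //; lia.
  rewrite !ifT; try lia.
  rewrite !scale1r !T2; try lia.
  rewrite /W !ifT; try lia.
  have -> : k = (m.*2 - j)%N by lia.
  rewrite -scalerBl -[_ ^+ j]signr_odd -[_ ^+ (_ - _)]signr_odd oddB; last lia.
  by rewrite odd_double /= subrr scale0r.
- have T3 p q r : (2 <= p)%N -> (2 <= q)%N -> (2 <= r)%N -> (p <= m.*2)%N ->
      (q <= m.*2)%N -> (r <= m.*2)%N ->
      table_lie t (e p) (table_lie t (e q) (e r)) = 0.
    move=> *; rewrite (T2 q r); try lia.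
    rewrite table_lieZ T2; try lia.
    by rewrite /W [X in _ *: (X *: _)]ifF ?scale0r ?scaler0 //; lia.
  by rewrite !T3 ?addr0 //; lia.
Qed.

End Families.

Section Algebras.

Variable K : numFieldType.

Definition s2 (n : nat) : lieAlgebra K :=
  LieAlgebra (table_lie_linear (s2_table K n)) (table_lie_antisym _)
    (s2_jacobi (n := n)).

Definition s4 (m : nat) (alpha : nat -> K) : lieAlgebra K :=
  LieAlgebra (table_lie_linear (s4_table m alpha)) (table_lie_antisym _)
    (s4_jacobi (m := m) alpha).

Definition tau3 (m : nat) : lieAlgebra K :=
  LieAlgebra (table_lie_linear (tau3_table K m)) (table_lie_antisym _)
    (tau3_jacobi (m := m)).

End Algebras.

Section Nilradical.

Variable K : numFieldType.

Lemma lie_linear_r (L : lieAlgebra K) (x : L) : linear (fun y => [Lie x, y]).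
Proof.
move=> c y z; rewrite lie_antisym lie_linear opprD -scalerN.
by rewrite -!(lie_antisym x).
Qed.

Lemma mem_lie_prod (L : lieAlgebra K) (U W : {vspace L}) (u w : L) :
  u \in U -> w \in W -> [Lie u, w] \in lie_prod U W.
Proof.
move=> uU wW; pose F x : {linear L -> L} :=
  HB.pack (fun y => [Lie x, y])
    (GRing.isLinear.Build _ _ _ _ _ (lie_linear_r x)).
pose G z : {linear L -> L} :=
  HB.pack (fun x => [Lie x, z])
    (GRing.isLinear.Build _ _ _ _ _ (lie_linear z)).
rewrite (coord_vbasis uU) -[[Lie _, _]]/(G w _) linear_sum; apply: memv_suml.
move=> i _; rewrite linearZ memvZ //= [in [Lie _, _]](coord_vbasis wW).
rewrite -[[Lie _, _]]/(F _ _) linear_sum; apply: memv_suml => j _.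
rewrite linearZ memvZ //= memv_span //; apply: allpairs_f; exact: memt_nth.
Qed.

(* The span of e_k, ..., e_n (for k > 0). *)
Definition bvec_span n k : {vspace s2 K n} :=
  <<[seq bvec K n i : s2 K n | i <- iota k (n.+1 - k)]>>%VS.

Lemma mem_bvec_span n k i : (k <= i)%N -> bvec K n i \in bvec_span n k.
Proof.
move=> ki; have [Hi|Hi] := leqP i n; last by rewrite bvec_gt ?mem0v.
apply: memv_span; apply/mapP; exists i => //; rewrite mem_iota; lia.
Qed.

Lemma bvec_span_coord n k (v : s2 K n) (i : 'I_n.+1) :
  v \in bvec_span n k -> (i < k)%N -> (v : 'rV_n.+1) 0 i = 0.
Proof.
move=> Hv ik; pose f (w : 'rV[K]_n.+1) : K^o := w 0 i.
have flin : linear f by move=> c w w'; rewrite /f !mxE.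
pose F : {linear 'rV[K]_n.+1 -> K^o} :=
  HB.pack f (GRing.isLinear.Build _ _ _ _ f flin).
suff /subvP/(_ _ Hv) : (bvec_span n k <= lker (linfun F))%VS.
  by rewrite memv_ker lfunE => /eqP.
apply/span_subvP => _ /mapP[j Hj ->]; rewrite memv_ker lfunE /= /f mxE.
rewrite mem_iota in Hj; case: (j =P i :> nat) => [ji|_]; last exact: eqxx.
by exfalso; lia.
Qed.

Lemma s2_nilradical n : (1 < n)%N -> is_nilradical (bvec_span n 1).
Proof.
move=> n1; split.
- move=> x y _; apply: memv_suml => i _; apply: memv_suml => j _.
  by rewrite memvZ // /s2_table; ifs; rewrite ?mem0v ?mem_bvec_span //; lia.
- exists n; suff H k : (lower_central (bvec_span n 1) k <= bvec_span n k.+1)%VS.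
    by apply/eqP; rewrite -subv0 (subv_trans (H n)) // /bvec_span subnn span_nil.
  elim: k => [|k IH]; first exact: subvv.
  apply/span_subvP => z /allpairsP[[v w] /= [/vbasis_mem Hv /vbasis_mem Hw ->]].
  have {}Hw := subvP IH _ Hw.
  apply: memv_suml => i _; apply: memv_suml => j _.
  rewrite /s2_table; case: ifP => [/andP[/eqP j1 i2]|_].
    have [ik|ki] := leqP i k; last by rewrite memvZ // mem_bvec_span.
    rewrite (bvec_span_coord (i := i) Hw) // (bvec_span_coord (i := j) Hw).
      by rewrite !mulr0 subrr scale0r mem0v.
    by lia.
  case: ifP => [/andP[/eqP j0 i2]|_]; last by rewrite scaler0 mem0v.
  rewrite (bvec_span_coord (i := j) Hw) ?(bvec_span_coord (i := j) Hv); try lia.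
  by rewrite mulr0 mul0r subrr scale0r mem0v.
- move=> I Iid [k Ik]; apply/subvP => v vI.
  have [v0|v0] := eqVneq ((v : 'rV_n.+1) 0 ord0) 0.
    have -> : v = \sum_(i < n.+1) (v : 'rV_n.+1) 0 i *: (bvec K n i : s2 K n).
      rewrite [LHS](@row_sum_delta K n.+1 v); apply: eq_bigr => i _.
      by congr (_ *: _); apply/rowP => j; rewrite !mxE eq_sym.
    apply: memv_suml => i _; have [i0|i0] := posnP i; last first.
      by rewrite memvZ // mem_bvec_span.
    by rewrite (_ : i = ord0) ?v0 ?scale0r ?mem0v //; apply: val_inj.
  pose e : s2 K n := bvec K n n.
  have eE (w : s2 K n) : [Lie e, w] = (w : 'rV_n.+1) 0 ord0 *: e.
    pose f (u : 'rV[K]_n.+1) : 'rV[K]_n.+1 :=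
      table_lie (s2_table K n) (bvec K n n) u - u 0 ord0 *: bvec K n n.
    have flin : linear f.
      move=> c u u'; rewrite /f table_lie_linear_r !mxE scalerDl -scalerA.
      by rewrite scalerBr opprD addrACA.
    apply/eqP; rewrite -subr_eq0; apply/eqP.
    apply: (row_linear0 flin) => i Hi.
    rewrite /f table_lie_bvec // mxE /s2_table; ifs;
      rewrite ?subr0 ?sub0r.
    all: try (have -> : (i == 0)%N = false by lia).
    all: try (have -> : (i == 0)%N by lia).
    all: rewrite /= ?scale1r ?scale0r ?subrr ?oppr0 ?subr0 //.
  have eI : e \in I.
    have := Iid e v vI; rewrite eE => /(memvZ ((v : 'rV_n.+1) 0 ord0)^-1).
    by rewrite scalerA mulVf // scale1r.
  have ek j : e \in lower_central I j.
    elim: j => [//|j IH]; have := mem_lie_prod vI IH.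
    rewrite lie_antisym eE -scaleNr => /(memvZ (- (v : 'rV_n.+1) 0 ord0)^-1).
    by rewrite scalerA mulVf ?oppr_eq0 // scale1r.
  have := ek k; rewrite Ik memv0 => /eqP/rowP/(_ ord_max)/eqP.
  by rewrite !mxE eqxx oner_eq0.
Qed.

End Nilradical.

(* Main.v *)
Require Import Defs.
From HB Require Import structures.
From mathcomp Require Import all_boot all_order all_algebra.
From mathcomp Require Import zify.
From mathcomp Require Import reals complex.

Set Implicit Arguments.
Unset Strict Implicit.
Unset Printing Implicit Defensive.

Import GRing.Theory Num.Theory.
Local Open Scope ring_scope.

(** Write e_1, ..., e_n, x for the basis of the given algebra, theta(x) = lambda
    (a scalar, the kernel being one-dimensional), v for a generator of the
    kernel V and psi for the cocycle. Right bracketing by x gives e_1 weight 0,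
    each e_i with i >= 2 weight 1 and v weight -lambda, and the cocycle identity
    only lets psi be nonzero between nilpotent elements when the weights match:
    [psi_weight1] says (1 + lambda) psi(e_n, e_1) = 0 and [psi_weight2] says
    (2 + lambda) psi(e_i, e_j) = 0 for i, j >= 2. Since e_n spans the centre of
    the nilradical, a non-split cocycle is nonzero on some (e_n, e_j)
    ([psi_top_neq0]), so lambda is -1 or -2.

    In both cases the extension is generated by x, by a lift f of a multiple of
    e_1 chosen so that [f, x] = 0, and by a lift u of e_2: with D = [., f], the
    chain u, D u, D^2 u, ... lifts e_2, e_3, ..., and as D commutes with [., x]
    every relation is determined by the brackets [u, x] and [D^i u, D^j u].

    - lambda = -1 ([weight1_extension]): psi vanishes on pairs (e_i, e_j) with
      i, j >= 2, hence the chain is abelian, it has length n, its last element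
      D^(n-1) u is a nonzero vector of V, and [u, x] = u + alpha v.  Either
      alpha = 0, which is s^2_(n+1), or rescaling e_1 by an (n-1)-st root turns
      alpha v into D^(n-1) u, which is s^4_(n+1)(0, ..., 0, 1).

    - lambda = -2 ([weight2_extension]): u can be lifted with [u, x] = u, and
      D^(n-1) u = 0 because V has weight 2.  As D kills V, the Jacobi identity
      reads [D y, y'] = - [y, D y'], so that all brackets are determined by
      beta_k = [u, D^k u]: [D^i u, D^j u] = (-1)^i beta_(i+j).  Antisymmetry
      forces beta_k = 0 for even k, and non-splitness says beta_(n-2) != 0;
      therefore n is odd.  Replacing u by u + a D^(2k) u with j + 2k = n - 2
      changes beta_j by 2 a beta_(n-2) and no beta_i with i > j, so all beta_j
      with j < n - 2 can be removed, from the top down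
      ([normalised_generator]).  What is left is the table of tau^3.

    In each case the family found is a basis because its image in the quotient
    is triangular with respect to x, e_1, ..., e_n ([leading_free]). *)

(** * Brackets and chains of iterated brackets *)

Section LieBasics.

Variables (K : numFieldType) (L : lieAlgebra K).
Implicit Types (x y z f : L) (c : K).

Lemma lieDl x y z : [Lie x + y, z] = [Lie x, z] + [Lie y, z].
Proof. by have := lie_linear z 1 x y; rewrite !scale1r. Qed.

Lemma lie0l x : [Lie 0, x] = 0.
Proof. by apply: (addrI [Lie 0, x]); rewrite -lieDl !addr0. Qed.

Lemma lieZl c x y : [Lie c *: x, y] = c *: [Lie x, y].
Proof. by have := lie_linear y c x 0; rewrite lie0l !addr0. Qed.

Lemma lieDr x y z : [Lie x, y + z] = [Lie x, y] + [Lie x, z].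
Proof. by have := lie_linear_r x 1 y z; rewrite !scale1r. Qed.

Lemma lie0r x : [Lie x, 0] = 0.
Proof. by rewrite lie_antisym lie0l oppr0. Qed.

Lemma lieZr c x y : [Lie x, c *: y] = c *: [Lie x, y].
Proof. by have := lie_linear_r x c y 0; rewrite lie0r !addr0. Qed.

Lemma lieNr x y : [Lie x, - y] = - [Lie x, y].
Proof. by rewrite -scaleN1r lieZr scaleN1r. Qed.

Lemma oppr_self_eq0 (W : lmodType K) (w : W) : w = - w -> w = 0.
Proof.
move/eqP; rewrite -addr_eq0 -mulr2n -scaler_nat scaler_eq0.
by rewrite pnatr_eq0 /= => /eqP.
Qed.

Lemma liexx x : [Lie x, x] = 0.
Proof. by apply: oppr_self_eq0; rewrite {1}lie_antisym. Qed.

Lemma lie_derivation x y f :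
  [Lie [Lie x, y], f] = [Lie [Lie x, f], y] + [Lie x, [Lie y, f]].
Proof.
have := lie_jacobi x y f; rewrite (lie_antisym f [Lie x, y]).
move/eqP; rewrite subr_eq0 => /eqP <-.
rewrite addrC (lie_antisym y) (lie_antisym f x) (lie_antisym _ y) lieNr opprK.
by rewrite -lie_antisym.
Qed.

(** All three target algebras are described by the powers of one right
    bracket acting on one element; [chain f x k] is (- ad f)^k x. *)
Definition chain f x k : L := iter k (fun y => [Lie y, f]) x.

Lemma chainS f x k : chain f x k.+1 = [Lie chain f x k, f].
Proof. by []. Qed.

Lemma chain_add f x i j : chain f (chain f x i) j = chain f x (i + j).
Proof. by rewrite /chain -iterD addnC. Qed.

Lemma chainDZ f c x y k :
  chain f (x + c *: y) k = chain f x k + c *: chain f y k.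
Proof. by elim: k => //= k ->; rewrite lieDl lieZl. Qed.

Lemma chain0 f k : chain f 0 k = 0.
Proof. by elim: k => //= k ->; rewrite lie0l. Qed.

Lemma chain_eq0 f x i j : chain f x i = 0 -> (i <= j)%N -> chain f x j = 0.
Proof. by move=> x0 /subnKC <-; rewrite -chain_add x0 chain0. Qed.

(** When f and y commute, so do the right brackets by f and by y. *)
Lemma lie_chain f x y k : [Lie f, y] = 0 ->
  [Lie chain f x k, y] = chain f [Lie x, y] k.
Proof.
move=> fy; elim: k => //= k IH.
by rewrite lie_derivation fy lie0r addr0 IH.
Qed.

End LieBasics.

(** * Recognising an algebra given by structure constants *)

Section TableIsomorphism.

Variables (K : numFieldType) (L : lieAlgebra K) (m : nat) (B : nat -> L).

Definition comb (v : 'rV[K]_m.+1) : L := \sum_(k < m.+1) v 0 k *: B k.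

Lemma comb_linear : linear comb.
Proof.
move=> c u v; rewrite /comb scaler_sumr -big_split; apply: eq_bigr => k _ /=.
by rewrite !mxE scalerDl scalerA.
Qed.

HB.instance Definition _ :=
  GRing.isLinear.Build K 'rV[K]_m.+1 L _ comb comb_linear.

Lemma comb_bvec k : (k <= m)%N -> comb (bvec K m k) = B k.
Proof.
move=> km; rewrite /comb (bigD1 (Ordinal (km : (k < m.+1)%N))) //= mxE eqxx.
rewrite scale1r big1 ?addr0 // => j; rewrite -val_eqE /= eq_sym => /negPf jk.
by rewrite mxE jk scale0r.
Qed.

(** A basis of L satisfying the relations of the table t identifies L with the
    algebra of that table; since m + 1 is the dimension, independence is enough.
    The Jacobi proof J is arbitrary, so that the lemma applies to each of the
    three families without unfolding how it was shown to be a Lie algebra. *)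
Lemma table_isomorphic (t : nat -> nat -> 'rV[K]_m.+1) J :
    \dim {:L} = m.+1 ->
    (forall v, comb v = 0 -> v = 0) ->
    (forall i j, (j < i)%N -> (i <= m)%N ->
       [Lie B i, B j] = comb (t i j) - comb (t j i)) ->
  lie_isomorphic L (@LieAlgebra K 'rV[K]_m.+1 (table_lie t)
    (table_lie_linear t) (table_lie_antisym t) J).
Proof.
move=> dimL inj_comb Bt.
pose F := linfun comb.
have FE v : F v = comb v by rewrite lfunE.
have kF : lker F == 0%VS.
  rewrite -subv0; apply/subvP => v; rewrite memv_ker FE memv0 => /eqP v0.
  exact/eqP/inj_comb.
have imF : limg F = fullv.
  apply/eqP; rewrite eqEdim subvf /= dimL.
  have := limg_ker_dim F fullv; rewrite capfv (eqP kF) dimv0 add0n => ->.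
  by rewrite dimvf /dim /= mul1n.
have FK : cancel F F^-1%VF by exact: lker0_lfunK.
have KF : cancel F^-1%VF F.
  by move=> y; apply: limg_lfunVK; rewrite imF memvf.
have Bt' i j : (i <= m)%N -> (j <= m)%N ->
    [Lie B i, B j] = comb (table_lie t (bvec K m i) (bvec K m j)).
  move=> im jm; rewrite table_lie_bvec // linearB.
  have [ij|ji|<-] := ltngtP i j; last by rewrite liexx subrr.
    by rewrite lie_antisym Bt // opprB.
  exact: Bt.
have row_sum_bvec (v : 'rV[K]_m.+1) : v = \sum_(i < m.+1) v 0 i *: bvec K m i.
  rewrite {1}[v]row_sum_delta; apply: eq_bigr => i _; congr (_ *: _).
  by apply/rowP => j; rewrite !mxE eq_sym.
have F_lie u v : F (table_lie t u v) = [Lie F u, F v].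
  rewrite !FE; apply/eqP; rewrite -subr_eq0; apply/eqP; move: u v.
  have eq0_bvec (g : 'rV[K]_m.+1 -> L) : linear g ->
      (forall i, (i <= m)%N -> g (bvec K m i) = 0) -> forall u, g u = 0.
    move=> glin g0 u.
    pose G : {linear 'rV[K]_m.+1 -> L} :=
      HB.pack g (GRing.isLinear.Build _ _ _ _ g glin).
    rewrite -[g u]/(G u) [u]row_sum_bvec linear_sum big1 // => i _.
    by rewrite linearZ /= g0 ?scaler0 // -ltnS.
  move=> u v; move: u; apply: (eq0_bvec).
    move=> c u u'; rewrite table_lie_linear !comb_linear lieDl lieZl.
    by rewrite scalerBr opprD addrACA.
  move=> i im; move: v; apply: (eq0_bvec).
    move=> c u u'; rewrite table_lie_linear_r !comb_linear lieDr lieZr.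
    by rewrite scalerBr opprD addrACA.
  by move=> j jm; rewrite !comb_bvec // Bt' // subrr.
exists F^-1%VF; split; first by exists F.
by move=> x y; apply: (can_inj FK); rewrite KF /= F_lie !KF.
Qed.

End TableIsomorphism.

Section ChainBases.

Variables (K : numFieldType) (L : lieAlgebra K).
Implicit Types (x f u z : L).

Definition chain_basis x f u (k : nat) : L :=
  match k with 0 => x | 1 => f | k'.+2 => chain f u k' end.

(** In tau^3 the vector of highest index is not in the chain of e_2: it only
    arises as a bracket of chain elements. *)
Definition capped_chain_basis n x f u z (k : nat) : L :=
  if k == n.+1 then z else chain_basis x f u k.

(** The parameter a covers at once s^2 (a = 0) and s^4(0, ..., 0, 1) (a = 1):
    bracketing [u, x] = u + a D^(n-1) u by f repeatedly shows that the
    exceptional term occurs for e_2 only, as D^n u = 0. *)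
Lemma s4_chain_relations n x f u (a : K) alpha : (3 <= n)%N ->
    (forall k, alpha k = a * (k == n)%:R) ->
    [Lie f, x] = 0 -> [Lie u, x] = u + a *: chain f u n.-1 ->
    chain f u n = 0 ->
    (forall i j, [Lie chain f u i, chain f u j] = 0) ->
  let B := chain_basis x f u in
  let t := s4_table n.+1 alpha in
  forall i j, (j < i)%N -> (i <= n.+1)%N ->
    [Lie B i, B j] = comb B (t i j) - comb B (t j i).
Proof.
move=> n3 alphaE fx ux un uu B t i j ji im.
(* Both chain_basis and bvec vanish past index n + 1, which spares the *)
(* boundary cases below. *)
have Bgt k : (n.+1 < k)%N -> B k = 0.
  by case: k => [|[|k]] // nk; apply: (chain_eq0 un).
have combE k : comb B (bvec K n.+1 k) = B k.
  have [kn|nk] := leqP k n.+1; first exact: comb_bvec.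
  by rewrite bvec_gt // linear0 Bgt.
case: j ji => [|[|j]] ji.
- case: i ji im => [|[|i]] // _ im.
    by rewrite /t /s4_table; ifs; rewrite subrr.
  rewrite /t /s4_table; ifs; rewrite linear0 subr0 linearD linear_sum /= combE.
  rewrite [LHS]lie_chain // ux chainDZ chain_add; congr (_ + _).
  have [i0|i0] := posnP i; last first.
    rewrite (chain_eq0 un) ?scaler0; last lia.
    rewrite big_nat_cond big1 // => l Hl; rewrite linearZ /= combE.
    rewrite alphaE; have [E|_] := eqVneq; last by rewrite mulr0 scale0r.
    by rewrite Bgt ?scaler0 //; lia.
  subst i; rewrite big_nat_recr /=; last lia.
  rewrite big_nat_cond big1 => [|l Hl]; last first.
    rewrite alphaE (_ : (l + 1 - 2 == n)%N = false); last lia.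
    by rewrite mulr0 scale0r linear0.
  rewrite add0r linearZ /= combE /= alphaE (_ : (_ == n) = true); last lia.
  rewrite mulr1.
  by congr (_ *: _); rewrite addn0; case: (n) n3.
- case: i ji im => [|[|i]] // _ im.
  rewrite /t /s4_table; have [inn|inn] := leqP i.+2 n.
    ifs; by rewrite linear0 subr0 combE.
  ifs; rewrite subrr -[LHS]/(chain f u i.+1); apply: (chain_eq0 un); lia.
- case: i ji im => [|[|i]] // _ im.
  rewrite /t /s4_table; ifs; by rewrite subrr; apply: uu.
Qed.

Lemma s4_chain n x f u : (3 <= n)%N ->
    \dim {:L} = n.+2 ->
    (forall v : 'rV_n.+2, comb (chain_basis x f u) v = 0 -> v = 0) ->
    [Lie f, x] = 0 -> [Lie u, x] = u + chain f u n.-1 ->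
    chain f u n = 0 ->
    (forall i j, [Lie chain f u i, chain f u j] = 0) ->
  lie_isomorphic L (s4 n.+1 (fun k => (k == n)%:R)).
Proof.
move=> n3 dimL Bfree fx ux un uu; apply: table_isomorphic dimL Bfree _.
apply: (@s4_chain_relations _ _ _ _ 1) => //; last by rewrite scale1r.
by move=> k; rewrite mul1r.
Qed.

Lemma s2_chain n x f u : (3 <= n)%N ->
    \dim {:L} = n.+2 ->
    (forall v : 'rV_n.+2, comb (chain_basis x f u) v = 0 -> v = 0) ->
    [Lie f, x] = 0 -> [Lie u, x] = u ->
    chain f u n = 0 ->
    (forall i j, [Lie chain f u i, chain f u j] = 0) ->
  lie_isomorphic L (s2 K n.+1).
Proof.
move=> n3 dimL Bfree fx ux un uu.
apply: table_isomorphic dimL Bfree _ => i j ji im; rewrite !s2_tableE.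
apply: (@s4_chain_relations _ _ _ _ 0) => //; last by rewrite scale0r addr0.
by move=> k; rewrite mul0r.
Qed.

Lemma tau3_chain m x f u z : (2 <= m)%N ->
    let B := capped_chain_basis m.*2.-1 x f u z in
    \dim {:L} = m.*2.+1 ->
    (forall v : 'rV_m.*2.+1, comb B v = 0 -> v = 0) ->
    [Lie f, x] = 0 -> [Lie u, x] = u -> [Lie z, x] = 2 *: z -> [Lie z, f] = 0 ->
    chain f u m.*2.-2 = 0 ->
    (forall i, [Lie z, chain f u i] = 0) ->
    (forall i j, [Lie chain f u i, chain f u j] =
       (-1) ^+ i * (i + j == m.*2 - 3)%N%:R *: z) ->
  lie_isomorphic L (tau3 K m).
Proof.
move=> m2 B dimL Bfree fx ux zx zf un zu uu.
apply: (@table_isomorphic _ _ _ B) => // i j ji im.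
have Blt k : (k < m.*2)%N -> B k = chain_basis x f u k.
  move=> km; rewrite /B /capped_chain_basis ifF //; lia.
have Btop : B m.*2 = z by rewrite /B /capped_chain_basis ifT //; lia.
rewrite (Blt j); last lia.
have [ilt|ige] := ltnP i m.*2; last first.
  have -> : i = m.*2 by lia.
  rewrite Btop; case: j ji => [|[|j]] ji /=.
  - rewrite zx /tau3_table; ifs.
    by rewrite linear0 subr0 linearZ /= comb_bvec // Btop.
  - by rewrite zf /tau3_table; ifs; rewrite subrr.
  - by rewrite zu /tau3_table; ifs; rewrite subrr.
rewrite Blt //; case: j ji => [|[|j]] ji.
- case: i ji im ilt => [|[|i]] // _ im ilt.
    by rewrite /tau3_table; ifs; rewrite subrr.
  rewrite [LHS]lie_chain // ux /tau3_table; ifs.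
  by rewrite linear0 subr0 comb_bvec // Blt.
- case: i ji im ilt => [|[|i]] // _ im ilt.
  rewrite /tau3_table; have [i3|i3] := leqP i.+2 (m.*2 - 2)%N.
    ifs; rewrite linear0 subr0 comb_bvec; last lia.
    by rewrite Blt //; lia.
  ifs; rewrite subrr -[LHS]/(chain f u i.+1); apply: (chain_eq0 un); lia.
- case: i ji im ilt => [|[|i]] // ji im ilt.
  rewrite [LHS]uu /tau3_table.
  have [ij|ij] := eqVneq (i.+2 + j.+2)%N (m.*2 + 1)%N; last first.
    rewrite (_ : (_ == _) = false) ?mulr0 ?scale0r; last lia.
    by ifs; rewrite subrr.
  rewrite (_ : (i + j == _)%N = true) ?mulr1; last lia.
  ifs; rewrite linear0 sub0r linearZ /= comb_bvec // Btop -scaleNr.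
  (* The table lists this bracket with its indices in the opposite order; *)
  (* the sum of the indices is odd, so the two signs differ. *)
  congr (_ *: _); have -> : i = (m.*2 - (j + 3))%N by lia.
  rewrite -signr_odd oddB; last lia.
  rewrite odd_double /= oddD -[RHS]mulN1r -exprS -[RHS]signr_odd /=.
  by case: (odd j).
Qed.

End ChainBases.

(** * Normalising the generator of the chain *)

(** Abstract setting for an extension of weight two: D is [., f], A stands for
    the elements of weight one over e_2, ..., e_n, and z for the generator of V.
    Only the values beta_k = [u, D^k u] are at stake. *)
Section Normalisation.

Variables (K : numFieldType) (L : lieAlgebra K) (f z u : L) (r : nat).
Variable A : L -> Prop.

Hypothesis A_u : A u.
Hypothesis A_linear : forall c x y, A x -> A y -> A (x + c *: y).
Hypothesis A_stable : forall x, A x -> A [Lie x, f].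
Hypothesis A_nilp : forall x, A x -> chain f x r.+1 = 0.
Hypothesis A_central : forall x y, A x -> A y -> [Lie [Lie x, y], f] = 0.
Hypothesis A_line : forall x y, A x -> A y -> exists c, [Lie x, y] = c *: z.

Lemma A_chain x k : A x -> A (chain f x k).
Proof. by move=> Ax; elim: k => //= k; apply: A_stable. Qed.

(** D is a derivation that kills brackets of elements of A, hence it is
    skew-symmetric for the bracket. *)
Lemma lie_chain_swap x y i : A x -> A y ->
  [Lie chain f x i, y] = (-1) ^+ i *: [Lie x, chain f y i].
Proof.
move=> Ax Ay; elim: i y Ay => [|i IH] y Ay; first by rewrite scale1r.
have := lie_derivation (chain f x i) y f.
rewrite (A_central (A_chain i Ax) Ay) => /esym/eqP; rewrite addr_eq0 => /eqP ->.
rewrite IH; last exact: A_stable.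
rewrite -scaleNr -mulN1r -exprS.
by rewrite -[chain f [Lie y, f] i]/(chain f (chain f y 1) i) chain_add.
Qed.

Lemma lie_chains x i j : A x ->
  [Lie chain f x i, chain f x j] = (-1) ^+ i *: [Lie x, chain f x (i + j)].
Proof.
by move=> Ax; rewrite lie_chain_swap ?chain_add 1?addnC //; apply: A_chain.
Qed.

(** Skew-symmetry of D makes (x, y) |-> [x, D^k y] antisymmetric for even k. *)
Lemma lie_chain_even x k : A x -> ~~ odd k -> [Lie x, chain f x k] = 0.
Proof.
move=> Ax /negPf k_even; apply: oppr_self_eq0; rewrite {1}lie_antisym.
by rewrite lie_chain_swap // -signr_odd k_even scale1r.
Qed.

(** The term of order two in a is a multiple of [x, D^(4k+i) x], and
    the bound on r makes that zero. *)
Lemma lie_chain_perturb x a k i : A x -> (r < k.*2 + (k.*2 + i))%N ->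
  [Lie x + a *: chain f x k.*2, chain f (x + a *: chain f x k.*2) i]
  = [Lie x, chain f x i] + (2 * a) *: [Lie x, chain f x (k.*2 + i)].
Proof.
move=> Ax rk; rewrite chainDZ chain_add !(lieDl, lieDr, lieZl, lieZr).
rewrite !lie_chains // -signr_odd odd_double !scale1r.
rewrite (chain_eq0 (A_nilp Ax) rk).
by rewrite lie0r !scaler0 addr0 -addrA -scalerDl mulr_natl mulr2n.
Qed.

(** The new generator is u + D w rather than an explicit combination of powers
    of D: this is stable under the successive corrections and suffices to see
    that the leading term of u is kept. *)
Lemma normalised_generator : odd r -> [Lie u, chain f u r] = z ->
  exists w, let u' := u + [Lie w, f] in
    [/\ A w, A u' &
        forall k, [Lie u', chain f u' k] = (k == r)%:R *: z].
Proof.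
move=> r_odd uz.
have A0 : A 0 by have := A_linear (-1) A_u A_u; rewrite scaleN1r subrr.
suff /(_ r (leqnn r))[w [Aw w_r w_lt]] : forall d, (d <= r)%N ->
    exists w, let u' := u + [Lie w, f] in
    [/\ A w, [Lie u', chain f u' r] = z &
        forall k, (r - d <= k < r)%N -> [Lie u', chain f u' k] = 0].
  have Au' : A (u + [Lie w, f]).
    by rewrite -[[Lie w, f]]scale1r; apply: A_linear => //; apply: A_stable.
  exists w; split => // k; have [kr|rk|->] := ltngtP k r.
  - by rewrite w_lt ?subnn // scale0r.
  - by rewrite (chain_eq0 (A_nilp Au') rk) lie0r scale0r.
  - by rewrite w_r scale1r.
(* d counts the values k < r, from the top, at which the bracket with D^k *)
(* has been made to vanish. *)
elim=> [|d IH] dr.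
  exists 0; rewrite lie0l addr0 subn0; split=> // k; lia.
have [w] := IH (ltnW dr); set v := u + _ => -[Aw v_r v_lt].
have Av : A v.
  by rewrite /v -[[Lie w, f]]scale1r; apply: A_linear => //; apply: A_stable.
set j := (r - d.+1)%N; have dj : (r - d = j.+1)%N by lia.
have [j_odd|j_even] := boolP (odd j); last first.
  exists w; split => // k kr.
  have [->|kj] := eqVneq k j; last by apply: v_lt; lia.
  exact: lie_chain_even.
have [k [k_gt0 jk]] : exists k, (0 < k)%N /\ (j + k.*2 = r)%N.
  by exists (r - j)./2; have := odd_double_half (r - j); lia.
(* Adding a D^(2k) v changes the bracket at j by 2 a z, which cancels c z. *)
have [c vj] := A_line Av (A_chain j Av).
set a := - c / 2.
have v'E : v + a *: chain f v k.*2 =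
    u + [Lie w + a *: chain f v k.*2.-1, f].
  rewrite lieDl lieZl addrA -chainS prednK //; lia.
exists (w + a *: chain f v k.*2.-1).
rewrite -v'E.
have lie_v' i : (j <= i)%N ->
    [Lie v + a *: chain f v k.*2, chain f (v + a *: chain f v k.*2) i]
    = [Lie v, chain f v i] + (2 * a) *: [Lie v, chain f v (k.*2 + i)].
  by move=> ji; apply: lie_chain_perturb => //; lia.
split.
- by apply: A_linear => //; apply: A_chain.
- rewrite lie_v' ?v_r ?(chain_eq0 (A_nilp Av) (j := (k.*2 + r))) //; try lia.
  by rewrite lie0r scaler0 addr0.
- move=> i ir; rewrite lie_v'; last lia.
  have [ij|ij] := eqVneq i j.
    subst i; rewrite vj addnC jk v_r -scalerDl /a mulrC divfK ?pnatr_eq0 //.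
    by rewrite subrr scale0r.
  rewrite v_lt ?(chain_eq0 (A_nilp Av) (j := (k.*2 + i))) //; try lia.
  by rewrite lie0r scaler0 addr0.
Qed.

End Normalisation.

(** * The structure of the base algebra *)

Section S2Structure.

Variables (K : numFieldType) (n : nat).
Hypothesis n_gt0 : (0 < n)%N.

Definition s2_basis (i : nat) : s2 K n := bvec K n i.
Local Notation e := s2_basis.

Lemma s2_basis_gt i : (n < i)%N -> e i = 0.
Proof. exact: bvec_gt. Qed.

Lemma s2_lie_e1 p : (2 <= p)%N -> [Lie e p, e 1] = e p.+1.
Proof.
move=> p2; have [pn|np] := leqP p n; last first.
  by rewrite (s2_basis_gt np) (s2_basis_gt (leqW np)) lie0l.
rewrite [LHS]table_lie_bvec // /s2_table; ifs; rewrite subr0 //.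
by rewrite s2_basis_gt //; lia.
Qed.

Lemma s2_lie_x p : (2 <= p)%N -> [Lie e p, e 0] = e p.
Proof.
move=> p2; have [pn|np] := leqP p n; last by rewrite s2_basis_gt ?lie0l.
by rewrite [LHS]table_lie_bvec // /s2_table; ifs; rewrite subr0.
Qed.

Lemma s2_lie_e1x : [Lie e 1, e 0] = 0.
Proof. by rewrite [LHS]table_lie_bvec // /s2_table; ifs; rewrite subr0. Qed.

Lemma s2_lie_span2 y z :
  y \in bvec_span K n 2 -> z \in bvec_span K n 2 -> [Lie y, z] = 0.
Proof.
move=> yS zS; rewrite /= /table_lie big1 // => i _; rewrite big1 // => j _.
have [j2|j2] := ltnP j 2.
  rewrite (bvec_span_coord (i := j) yS) // (bvec_span_coord (i := j) zS) //.
  by rewrite mulr0 mul0r subrr scale0r.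
by rewrite /s2_table; ifs; rewrite scaler0.
Qed.

Lemma mem_s2_basis k i : (k <= i)%N -> e i \in bvec_span K n k.
Proof. exact: mem_bvec_span. Qed.

Lemma s2_lie_e i j : (2 <= i)%N -> (2 <= j)%N -> [Lie e i, e j] = 0.
Proof. by move=> i2 j2; apply: s2_lie_span2; apply: mem_s2_basis. Qed.

Lemma s2_span_lie_e1 k y : (2 <= k)%N -> y \in bvec_span K n k ->
  [Lie y, e 1] \in bvec_span K n k.+1.
Proof.
move=> k2 yS.
pose g : {linear s2 K n -> s2 K n} := HB.pack (fun y : s2 K n => [Lie y, e 1])
  (GRing.isLinear.Build _ _ _ _ _ (lie_linear (e 1))).
suff /subvP/(_ _ yS) :
    (bvec_span K n k <= linfun g @^-1: bvec_span K n k.+1)%VS.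
  by rewrite -memv_preim lfunE.
apply/span_subvP => _ /mapP[i + ->]; rewrite mem_iota => /andP[ki _].
rewrite -memv_preim lfunE /= -/(s2_basis i) [X in X \in _]s2_lie_e1.
  exact: mem_bvec_span.
exact: leq_trans ki.
Qed.

Lemma bvec_spanS k : (bvec_span K n k.+1 <= bvec_span K n k)%VS.
Proof.
apply/span_subvP => _ /mapP[i + ->]; rewrite mem_iota => /andP[ki _].
exact/mem_bvec_span/ltnW.
Qed.

Lemma bvec_span_top y : y \in bvec_span K n n.+1 -> y = 0.
Proof. by rewrite /bvec_span subnn span_nil memv0 => /eqP. Qed.

Lemma span_linear_eq0 k (W : vectType K) (g : s2 K n -> W) y : linear g ->
  (forall i, (k <= i)%N -> g (e i) = 0) -> y \in bvec_span K n k -> g y = 0.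
Proof.
move=> glin g0 yS.
pose G : {linear s2 K n -> W} :=
  HB.pack g (GRing.isLinear.Build _ _ _ _ g glin).
suff /subvP/(_ _ yS) : (bvec_span K n k <= lker (linfun G))%VS.
  by rewrite memv_ker lfunE => /eqP.
apply/span_subvP => _ /mapP[i + ->]; rewrite mem_iota => /andP[ki _].
by rewrite memv_ker lfunE; apply/eqP/g0.
Qed.

Lemma s2_top_central : (1 < n)%N -> in_center (bvec_span K n 1) (e n).
Proof.
move=> n_gt1; split=> [|y]; first exact: mem_s2_basis.
apply: (span_linear_eq0 (lie_linear_r (e n))) => -[|[|i]] // _.
  by rewrite s2_lie_e1 // s2_basis_gt.
exact: s2_lie_e.
Qed.

(** Triangularity with respect to x, e_1, ..., e_n: y has lowest term e_i. *)
Definition leading i (y : s2 K n) :=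
  exists2 c, c != 0 & y - c *: e i \in bvec_span K n i.+1.

Lemma leading_basis i c : c != 0 -> leading i (c *: e i).
Proof. by move=> c0; exists c; rewrite // subrr mem0v. Qed.

Lemma leading_lie_e1 i s y : (2 <= i)%N -> s != 0 ->
  leading i y -> leading i.+1 [Lie y, s *: e 1].
Proof.
move=> i2 s0 [c c0 yS]; exists (s * c); first by rewrite mulf_neq0.
rewrite lieZr -scalerA -scalerBr memvZ //.
have := s2_span_lie_e1 (leqW i2) yS.
by rewrite lieDl -scaleNr lieZl s2_lie_e1 // scaleNr.
Qed.

Lemma leading_coord i y (j : 'I_n.+1) : leading i y -> (j <= i)%N ->
  (j == i :> nat) = ((y : 'rV_n.+1) 0 j != 0).
Proof.
move=> [c c0 yS] ji; have := bvec_span_coord (i := j) yS ji.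
rewrite !mxE eq_sym => /eqP; rewrite subr_eq0 => /eqP->.
by case: eqP; rewrite ?mulr1 ?mulr0 ?c0 ?eqxx.
Qed.

Variables (V : vectType K) (E : ext_data (s2 K n) V).

(** The components in the base algebra are triangular, so the coefficients of a
    vanishing combination are zero one after the other; the last vector is a
    nonzero element of V. *)
Lemma leading_free (B : nat -> extension E) :
    (forall i, (i <= n)%N -> leading i (B i).1) ->
    (B n.+1).1 = 0 -> (B n.+1).2 != 0 ->
  forall v : 'rV_n.+2, comb B v = 0 -> v = 0.
Proof.
move=> lead_B B1 B2 v combv0.
have v_le k : (k <= n)%N -> v 0 (inord k) = 0.
  elim/ltn_ind: k => k IH kn.
  have : (((comb B v).1 : s2 K n) : 'rV_n.+1) 0 (inord k) = 0.
    by rewrite combv0 mxE.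
  rewrite /comb (raddf_sum fst) summxE.
  rewrite (bigD1 (inord k)) //= big1 => [|i].
    rewrite addr0 mxE inordK; last lia.
    move/eqP; rewrite mulf_eq0 => /orP[/eqP //|/idPn[]].
    by rewrite -(leading_coord (lead_B k kn)) inordK.
  rewrite -val_eqE /= inordK; last lia.
  move=> ik; rewrite mxE; have [{}ik|ki|/eqP] := ltngtP i k.
  - by rewrite -(inord_val i) IH ?mul0r //; lia.
  - have [i_n|i_n] := leqP i n; last first.
      have -> : nat_of_ord i = n.+1 by have := ltn_ord i; lia.
      by rewrite B1 mxE mulr0.
    have := leading_coord (j := inord k) (lead_B i i_n).
    rewrite inordK // => /(_ (ltnW ki)).
    case: eqP => [|_ /esym/negbFE/eqP->]; first lia.
    by rewrite mulr0.
  - by rewrite (negPf ik).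
apply/rowP => i; rewrite mxE; have [i_n|i_n] := leqP i n.
  by rewrite -(inord_val i) v_le.
have iE : nat_of_ord i = n.+1 by have := ltn_ord i; lia.
have : (comb B v).2 = 0 by rewrite combv0.
rewrite /comb (raddf_sum snd) (bigD1 i) //= big1 ?addr0.
  by rewrite iE => /eqP; rewrite scaler_eq0 (negPf B2) orbF => /eqP.
move=> j; rewrite -val_eqE /= => ji.
rewrite -(inord_val j) v_le ?scale0r //; have := ltn_ord j; lia.
Qed.

Lemma dim_extension : \dim {:V} = 1%N -> \dim {: extension E} = n.+2.
Proof.
rewrite !dimvf => V1.
have -> : dim (extension E) = (dim (s2 K n) + dim V)%N by [].
rewrite V1 addn1; congr S; by rewrite -[LHS]/(1 * n.+1)%N mul1n.
Qed.

End S2Structure.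

Lemma dim1_line (K : fieldType) (V : vectType K) : \dim {:V} = 1%N ->
  forall w u : V, w != 0 -> exists c, u = c *: w.
Proof.
move=> V1 w u w0; apply/vlineP; suff -> : <[w]>%VS = fullv by exact: memvf.
by apply/eqP; rewrite eqEdim subvf V1 dim_vline w0.
Qed.

(** * One-dimensional extensions and their weights *)

Section Extensions.

Variables (K : numFieldType) (n : nat) (V : vectType K).
Variable E : ext_data (s2 K n) V.
Local Notation e := (s2_basis K n).
Local Notation psi := (ext_psi E).
Local Notation theta := (ext_theta E).
Implicit Types (y z : s2 K n) (u w : V).

Lemma psi0l y : psi 0 y = 0.
Proof.
by have := ext_psi_linear E y (-1) 0 0; rewrite scaler0 addr0 scaleN1r addNr.
Qed.

Lemma psiZl c y z : psi (c *: y) z = c *: psi y z.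
Proof. by have := ext_psi_linear E z c y 0; rewrite psi0l !addr0. Qed.

Lemma psi0r y : psi y 0 = 0.
Proof. by rewrite ext_psi_antisym psi0l oppr0. Qed.

Lemma psiZr c y z : psi y (c *: z) = c *: psi y z.
Proof. by rewrite ext_psi_antisym psiZl -scalerN -ext_psi_antisym. Qed.

Lemma psiNr y z : psi y (- z) = - psi y z.
Proof. by rewrite -scaleN1r psiZr scaleN1r. Qed.

Hypothesis n_ge3 : (3 <= n)%N.
Hypothesis theta_nil : forall y, y \in bvec_span K n 1 -> theta y = 0.

Let n_gt0 : (0 < n)%N := ltnW (ltnW n_ge3).

Local Notation ext y u := ((y, u) : extension E).

Lemma extension_lieE y z u w :
  [Lie ext y u, ext z w] = ext [Lie y, z] (psi y z + theta y w - theta z u).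
Proof. by []. Qed.

Lemma theta_e i u : (1 <= i)%N -> theta (e i) u = 0.
Proof. by move=> i1; rewrite theta_nil ?mem_s2_basis // lfunE. Qed.

Lemma theta_Ze c i u : (1 <= i)%N -> theta (c *: e i) u = 0.
Proof. by move=> i1; rewrite linearZ scale_lfunE theta_e ?scaler0. Qed.

Lemma fst_chain (f a : extension E) k :
  (chain f a k).1 = chain f.1 a.1 k :> s2 K n.
Proof. by elim: k => //= k ->. Qed.

Lemma chain_e s k : chain (s *: e 1) (e 2) k = s ^+ k *: e k.+2.
Proof.
elim: k => [|k IH]; first by rewrite scale1r.
by rewrite chainS IH lieZl lieZr (s2_lie_e1 _ n_gt0) ?scalerA -?exprSr //; lia.
Qed.

Section Weight.

Variable lambda : K.
Hypothesis theta_x : forall u, theta (e 0) u = lambda *: u.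

(** The cocycle identity at (x, e_i, e_j), where [e_i, e_j] = 0. *)
Lemma psi_weight2 i j : (2 <= i)%N -> (2 <= j)%N ->
  (2 + lambda) *: psi (e i) (e j) = 0.
Proof.
move=> i2 j2; have := ext_psi_cocycle E (e 0) (e i) (e j).
rewrite (s2_lie_e _ n_gt0 i2 j2) psi0r add0r.
rewrite (lie_antisym (e 0)) !(s2_lie_x _ n_gt0); try lia.
rewrite psiNr -ext_psi_antisym (theta_e _ (ltnW i2)) (theta_e _ (ltnW j2)).
by rewrite !addr0 theta_x scalerDl scaler_nat mulr2n.
Qed.

(** The cocycle identity at (x, e_n, e_1), where [e_n, e_1] = 0. *)
Lemma psi_weight1 : (1 + lambda) *: psi (e n) (e 1) = 0.
Proof.
have := ext_psi_cocycle E (e 0) (e n) (e 1).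
rewrite (s2_lie_e1 _ n_gt0) ?(s2_basis_gt K (ltnSn n)) ?psi0r ?add0r; try lia.
rewrite (lie_antisym (e 0)) (s2_lie_x _ n_gt0) ?(s2_lie_e1x _ n_gt0); last lia.
rewrite psi0r addr0.
rewrite psiNr -ext_psi_antisym (theta_e _ n_gt0) (theta_e _ (ltnSn 0)) !addr0.
by rewrite theta_x scalerDl scale1r.
Qed.

Lemma lie_V w y u : [Lie ext 0 w, ext y u] = ext 0 (- theta y w).
Proof. by rewrite extension_lieE lie0l psi0l linear0 zero_lfunE !add0r. Qed.

Definition ext_x := ext (e 0) 0.
(** The lift of s e_1 that commutes with x. As x acts on V by lambda, a
    V-component w contributes - lambda w to the bracket with x, which has to
    cancel psi(s e_1, x). *)
Definition ext_f s := ext (s *: e 1) (lambda^-1 *: psi (s *: e 1) (e 0)).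

Lemma lie_f_x s : lambda != 0 -> [Lie ext_f s, ext_x] = 0.
Proof.
move=> l0; rewrite extension_lieE lieZl (s2_lie_e1x _ n_gt0) scaler0.
by rewrite linear0 addr0 theta_x scalerA divff // scale1r subrr.
Qed.

Lemma lie_V_f s w : [Lie ext 0 w, ext_f s] = 0.
Proof. by rewrite lie_V theta_Ze // oppr0. Qed.

Lemma lie_V_x w : [Lie ext 0 w, ext_x] = ext 0 (- lambda *: w).
Proof. by rewrite lie_V theta_x scaleNr. Qed.

Lemma leading_chain s (a : extension E) k : s != 0 -> leading 2 a.1 ->
  leading k.+2 (chain (ext_f s) a k).1.
Proof. by move=> s0 la; elim: k => //= k; apply: (leading_lie_e1 n_gt0). Qed.

Lemma fst_chain_e s w k :
  (chain (ext_f s) (ext (e 2) w) k).1 = s ^+ k *: e k.+2.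
Proof. by rewrite fst_chain chain_e. Qed.

(** After the elements lifting e_2, ..., e_n the chain enters V. *)
Lemma chain_top s w : chain (ext_f s) (ext (e 2) w) n.-1
  = ext 0 (s ^+ n.-1 *: psi (e n) (e 1)).
Proof.
have -> : n.-1 = n.-2.+1 by lia.
rewrite chainS [chain _ _ _]surjective_pairing fst_chain_e.
rewrite (_ : n.-2.+2 = n); last lia.
rewrite extension_lieE !theta_Ze // subr0 addr0.
rewrite psiZl psiZr scalerA -exprSr lieZl lieZr (s2_lie_e1 _ n_gt0); last lia.
by rewrite (s2_basis_gt K (ltnSn n)) !scaler0.
Qed.

End Weight.

(** * Identifying the extensions of weight one and two *)

Hypothesis psi_top :
  ~ (forall y, y \in bvec_span K n 1 -> psi (e n) y = 0).
Hypothesis V1 : \dim {:V} = 1%N.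

Lemma psi_top_neq0 :
  psi (e n) (e 1) != 0 \/ exists2 j, (2 <= j)%N & psi (e n) (e j) != 0.
Proof.
have [//|psi1] := boolP (psi (e n) (e 1) != 0); first by left.
right; case: (pickP (fun j : 'I_n.+1 => (2 <= j)%N && (psi (e n) (e j) != 0))).
  by move=> j /andP[j2 pj]; exists j.
move=> no_j; exfalso; apply: psi_top => y yS.
rewrite ext_psi_antisym; apply/eqP; rewrite oppr_eq0; apply/eqP.
apply: (span_linear_eq0 (ext_psi_linear E (e n)) _ yS) => i i1.
apply/eqP; rewrite ext_psi_antisym oppr_eq0.
have [i_n|n_i] := leqP i n; last by rewrite (s2_basis_gt K n_i) psi0r.
have [->|i_neq1] := eqVneq i 1%N; first exact: negbNE.
have := no_j (Ordinal (i_n : (i < n.+1)%N)).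
by rewrite /= ltn_neqAle eq_sym i_neq1 i1 => /negbFE.
Qed.

Lemma leading_fe s lambda (a : extension E) i : s != 0 -> leading 2 a.1 ->
  leading i (chain_basis ext_x (ext_f lambda s) a i).1.
Proof.
move=> s0 lead_a; case: i => [|[|i]].
- by rewrite -[X in leading _ X]scale1r; apply: leading_basis; rewrite oner_eq0.
- exact: leading_basis.
- exact: leading_chain.
Qed.

(** The scalar s rescales e_1; with s^(n-1) = alpha the defect of [u, x] becomes
    exactly the last element of the chain. *)
Lemma weight1_extension s alpha : s != 0 ->
    (forall u, theta (e 0) u = -1 *: u) ->
    psi (e 2) (e 0) = alpha *: psi (e n) (e 1) ->
    [\/ alpha = 0 | alpha = s ^+ n.-1] ->
  lie_isomorphic (extension E) (s2 K n.+1) \/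
  lie_isomorphic (extension E) (s4 n.+1 (fun k => (k == n)%:R)).
Proof.
move=> s0 theta_x psi_2x alphaE.
have psi_2 i j : (2 <= i)%N -> (2 <= j)%N -> psi (e i) (e j) = 0.
  move=> i2 j2; have := psi_weight2 theta_x i2 j2.
  by rewrite [2 + _](addrK 1 1) scale1r.
have psi_n1 : psi (e n) (e 1) != 0.
  by case: psi_top_neq0 => // -[j j2 /eqP[]]; apply: psi_2 => //; lia.
have l0 : -1 != 0 :> K by rewrite oppr_eq0 oner_eq0.
pose f := ext_f (-1) s; pose u := ext (e 2) 0.
have fx : [Lie f, ext_x] = 0 by exact: (lie_f_x theta_x).
have ux : [Lie u, ext_x] = u + ext 0 (alpha *: psi (e n) (e 1)).
  rewrite extension_lieE (s2_lie_x _ n_gt0) // theta_e // theta_x scaler0.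
  rewrite subr0 addr0 psi_2x.
  by congr pair; rewrite /= ?addr0 ?add0r.
have u_top : chain f u n.-1 = ext 0 (s ^+ n.-1 *: psi (e n) (e 1)).
  exact: chain_top.
have un : chain f u n = 0.
  have : [Lie chain f u n.-1, f] = 0 by rewrite u_top lie_V_f.
  by rewrite -chainS prednK.
have uu i j : [Lie chain f u i, chain f u j] = 0.
  rewrite [chain f u i]surjective_pairing [chain f u j]surjective_pairing.
  rewrite !fst_chain_e extension_lieE !theta_Ze // lieZl lieZr.
  by rewrite psiZl psiZr psi_2 // (s2_lie_e _ n_gt0) // !scaler0 subr0 addr0.
have free (v : 'rV_n.+2) : comb (chain_basis ext_x f u) v = 0 -> v = 0.
  have nE : n.+1 = n.-1.+2 by lia.
  apply: (leading_free n_gt0).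
  - move=> i _; apply: leading_fe => //=.
    rewrite -[X in leading _ X]scale1r; apply: leading_basis.
    exact: oner_neq0.
  - by rewrite nE /= u_top.
  - by rewrite nE /= u_top /= scaler_eq0 negb_or expf_neq0.
have dimE := dim_extension E V1.
case: alphaE => alphaE; [left | right].
  apply: (s2_chain n_ge3 dimE free fx) => //.
  by rewrite ux alphaE scale0r; apply: addr0.
apply: (s4_chain n_ge3 dimE free fx) => //.
by rewrite ux alphaE u_top.
Qed.

(** The subspace A of elements of weight one over e_2, ..., e_n satisfies the
    hypotheses of [normalised_generator] with r = n - 2. *)
Lemma weight2_extension :
    (forall u, theta (e 0) u = -2 *: u) -> psi (e n) (e 1) = 0 ->
  odd n /\ lie_isomorphic (extension E) (tau3 K n.+1./2).
Proof.
move=> theta_x psi_n1.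
have [j j2 psi_nj] : exists2 j, (2 <= j)%N & psi (e n) (e j) != 0.
  by case: psi_top_neq0 => //; rewrite psi_n1 eqxx.
have l0 : -2 != 0 :> K by rewrite oppr_eq0 pnatr_eq0.
pose f := ext_f (-2) 1; pose u := ext (e 2) (- psi (e 2) (e 0)).
have fx : [Lie f, ext_x] = 0 by exact: (lie_f_x theta_x).
have ux : [Lie u, ext_x] = u.
  rewrite extension_lieE (s2_lie_x _ n_gt0) // linear0 addr0 theta_x.
  congr pair; rewrite scalerN opprK scaleNr scaler_nat mulr2n opprD addrA subrr.
  by rewrite sub0r.
pose A (y : extension E) := y.1 \in bvec_span K n 2 /\ [Lie y, ext_x] = y.
have A_u : A u by split; first exact: mem_s2_basis.
have A_linear c (x y : extension E) : A x -> A y -> A (x + c *: y).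
  move=> [x1 xx] [y1 yx]; split; first by apply: rpredD => //; apply: rpredZ.
  by rewrite lieDl lieZl xx yx.
have f1 (y : extension E) k : (2 <= k)%N -> y.1 \in bvec_span K n k ->
    [Lie y, f].1 \in bvec_span K n k.+1.
  by move=> k2 yk; rewrite /= scale1r; apply: (s2_span_lie_e1 n_gt0).
have A_stable (y : extension E) : A y -> A [Lie y, f].
  move=> [y1 yx]; split; first exact/(subvP (bvec_spanS _ _ 2))/f1.
  by rewrite (lie_chain y 1 fx) yx.
have line0 (y : extension E) : y.1 = 0 -> exists v, y = ext 0 v.
  by case: y => y1 v /= ->; exists v.
have A_nilp (y : extension E) : A y -> chain f y n.-2.+1 = 0.
  move=> [y1 yx]; have yk k : (chain f y k).1 \in bvec_span K n k.+2.
    by elim: k => // k; apply: f1.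
  have [|v yE] := line0 (chain f y n.-2.+1).
    by apply: bvec_span_top; rewrite (_ : n.+1 = n.-2.+3) //; lia.
  (* This element of V has weight both 1 and 2, so it is zero. *)
  have := lie_chain y n.-2.+1 fx; rewrite yx yE (lie_V_x theta_x) opprK.
  move=> /(congr1 snd)/= /eqP; rewrite scaler_nat mulr2n.
  by rewrite -subr_eq0 addrK => /eqP ->.
have A_abel (y z : extension E) : A y -> A z -> exists v, [Lie y, z] = ext 0 v.
  by move=> [y1 _] [z1 _]; apply: line0; apply: (s2_lie_span2 n_gt0).
pose r := n.-2; pose z := [Lie u, chain f u r].
have A_ch (y : extension E) k : A y -> A (chain f y k) by exact: A_chain.
have [v zE] : exists v, z = ext 0 v by apply: A_abel => //; apply: A_ch.
have A_central (y y' : extension E) : A y -> A y' -> [Lie [Lie y, y'], f] = 0.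
  by move=> Ay Ay'; have [t ->] := A_abel y y' Ay Ay'; apply: lie_V_f.
have nE : n.-2.+2 = n by lia.
(* Up to sign psi(e_n, e_j) is [u, D^(n+j-4) u], which is zero unless j = 2, *)
(* when it is z. *)
have v0 : v != 0.
  apply: contraNneq psi_nj => v0.
  have := lie_chains A_stable A_central n.-2 j.-2 A_u.
  move=> /(congr1 snd).
  rewrite [chain f u n.-2]surjective_pairing [chain f u j.-2]surjective_pairing.
  rewrite !fst_chain_e extension_lieE !theta_Ze // subr0 addr0 !expr1n !scale1r.
  rewrite nE (_ : j.-2.+2 = j); last lia.
  rewrite -[LHS]/(psi (e n) (e j)) => ->; have [j2'|j_gt2] := posnP j.-2.
    by rewrite j2' addn0 -/r -/z zE v0 /= scaler0.
  rewrite (chain_eq0 (A_nilp u A_u)) ?lie0r /= ?scaler0 //; lia.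
have A_line (y y' : extension E) : A y -> A y' ->
    exists c, [Lie y, y'] = c *: z.
  move=> Ay Ay'; have [t ->] := A_abel y y' Ay Ay'.
  have [c ->] := dim1_line V1 t v0; exists c; rewrite zE.
  by congr pair; rewrite /= scaler0.
have r_odd : odd r.
  apply: contraNT v0 => /(lie_chain_even A_stable A_central A_u).
  by rewrite [LHS]zE => /(congr1 snd)/= ->.
have n_odd : odd n by rewrite -nE /= negbK.
have [w [Aw Au' u'_lie]] := normalised_generator A_u A_linear A_stable A_nilp
  A_central A_line r_odd erefl.
set u' := u + _ in Au' u'_lie.
have [m m2] : exists m, m.*2 = n.+1.
  by exists n.+1./2; have := odd_double_half n.+1; rewrite /= n_odd.
have mE : n.+1./2 = m by rewrite -m2 doubleK.
split=> //; rewrite mE.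
(* The correction [w, f] lies over e_3, ..., e_n. *)
have lead_u' : leading 2 u'.1.
  exists 1; rewrite ?oner_eq0 // scale1r.
  rewrite [u'.1](_ : _ = e 2 + [Lie w, f].1) // [X in X \in _]addrC addKr.
  by apply: f1 => //; case: Aw.
have lie_zx : [Lie z, ext_x] = 2 *: z.
  rewrite zE (lie_V_x theta_x) opprK; congr pair; by rewrite /= scaler0.
apply: (tau3_chain (x := ext_x) (f := f) (u := u') (z := z)).
- lia.
- by rewrite m2; apply: dim_extension.
- rewrite m2 /= => t; apply: (leading_free n_gt0).
  + move=> i i_n; rewrite /capped_chain_basis ifF; last lia.
    by apply: leading_fe; rewrite ?oner_eq0.
  + by rewrite /capped_chain_basis eqxx zE.
  + by rewrite /capped_chain_basis eqxx zE.
- exact: fx.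
- by case: Au'.
- exact: lie_zx.
- by rewrite zE lie_V_f.
- by rewrite (_ : m.*2.-2 = n.-2.+1) ?A_nilp //; lia.
- move=> i; rewrite zE [chain _ _ _]surjective_pairing lie_V theta_nil.
    by rewrite zero_lfunE oppr0.
  by have [/(subvP (bvec_spanS _ _ 1))] := A_ch u' i Au'.
- move=> i k; rewrite (lie_chains A_stable A_central) // u'_lie scalerA.
  by congr (_ * _%:R *: _); rewrite (_ : (m.*2 - 3 = r)%N) // /r; lia.
Qed.

End Extensions.

(** * The classification *)

Section Classification.

Variables (K : numClosedFieldType) (n : nat) (N : {vspace s2 K n}).
Variables (V : vectType K) (E : ext_data (s2 K n) V).

(** Algebraic closedness provides the (n-1)-st root used to rescale e_1. *)
Lemma s2_extension_cases :
  (3 <= n)%N -> is_nilradical N -> \dim {:V} = 1%N ->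
  ext_central E N -> ext_nonsplit E N ->
  [\/ lie_isomorphic (extension E) (s2 K n.+1),
      lie_isomorphic (extension E) (s4 n.+1 (fun k => (k == n)%:R : K))
    | odd n /\ lie_isomorphic (extension E) (tau3 K n.+1./2)].
Proof.
move=> n_ge3 [N_id N_nil N_max] V1 E_central E_nonsplit.
have n_gt0 : (0 < n)%N by lia.
have [S_id S_nil S_max] := @s2_nilradical K n (ltnW n_ge3).
(* The nilradical is the largest nilpotent ideal, hence unique. *)
have NE : N = bvec_span K n 1.
  by apply/eqP; rewrite eqEsubv S_max // N_max.
rewrite {}NE in E_central E_nonsplit.
have psi_top : ~ (forall y, y \in bvec_span K n 1 ->
    ext_psi E (s2_basis K n n) y = 0).
  have e_central := s2_top_central K n_gt0 (ltnW n_ge3).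
  move=> /(E_nonsplit _ e_central)/rowP/(_ ord_max)/eqP.
  by rewrite !mxE eqxx oner_eq0.
have [w w0] : exists w : V, w != 0.
  exists (vpick {:V}); rewrite vpick0 -dimv_eq0 V1 //.
have [lambda theta_w] := dim1_line V1 (ext_theta E (s2_basis K n 0) w) w0.
have theta_x u : ext_theta E (s2_basis K n 0) u = lambda *: u.
  have [c ->] := dim1_line V1 u w0.
  by rewrite linearZ /= theta_w !scalerA mulrC.
have weight1 := psi_weight1 n_ge3 E_central theta_x.
have [psi_n1|psi_n1] := eqVneq (ext_psi E (s2_basis K n n) (s2_basis K n 1)) 0.
  constructor 3; apply: weight2_extension => // u.
  have [|[j j2 psi_nj]] := psi_top_neq0 psi_top; first by rewrite psi_n1 eqxx.
  have := psi_weight2 n_ge3 E_central theta_x (ltnW n_ge3) j2.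
  move/eqP; rewrite scaler_eq0 (negPf psi_nj) orbF addrC addr_eq0 => /eqP l2.
  by rewrite theta_x l2.
have theta_x1 u : ext_theta E (s2_basis K n 0) u = -1 *: u.
  move/eqP: weight1; rewrite scaler_eq0 (negPf psi_n1) orbF addrC addr_eq0.
  by move=> /eqP l1; rewrite theta_x l1.
have [alpha psi_2x] :=
  dim1_line V1 (ext_psi E (s2_basis K n 2) (s2_basis K n 0)) psi_n1.
have [s s0 alphaE] : exists2 s, s != 0 & [\/ alpha = 0 | alpha = s ^+ n.-1].
  have [->|alpha0] := eqVneq alpha 0.
    by exists 1; [exact: oner_neq0 | left].
  exists (n.-1.-root alpha); last by right; rewrite rootCK //; lia.
  by rewrite rootC_eq0 //; lia.
have := weight1_extension n_ge3 E_central psi_top V1 s0 theta_x1 psi_2x alphaE.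
by case=> ?; [constructor 1 | constructor 2].
Qed.

End Classification.

Theorem theorem5p5 (R : realType) (n : nat) (N : {vspace s2 R[i] n})
    (V : vectType R[i]) (E : ext_data (s2 R[i] n) V) :
  (3 <= n)%N ->
  is_nilradical N ->
  \dim {:V} = 1%N ->
  ext_central E N ->
  ext_nonsplit E N ->
  [\/ lie_isomorphic (extension E) (s2 R[i] n.+1),
      lie_isomorphic (extension E) (s4 n.+1 (fun k => (k == n)%:R : R[i]))
    | odd n /\ lie_isomorphic (extension E) (tau3 R[i] n.+1./2)].
Proof. exact: s2_extension_cases. Qed.
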